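(* For all $n\geq 0$, the number of desarrangements of length $n$ avoiding both $123$ and $231$ is \[ d_n(123,231)=\frac{2n(n-1)+(5-2n)(-1)^n+3}{8}. \]
   Context: Permutations are in one-line notation; $\mathfrak{S}_0$ consists of the empty permutation, which is considered a desarrangement. An index $i\in[n-1]$ is a descent of $\pi\in\mathfrak{S}_n$ if $\pi_i>\pi_{i+1}$; $i\in[n]$ is an ascent if it is not a descent (so $n$ is always an ascent). A desarrangement is a permutation whose first ascent is even. $d_n(\Pi)$ is the number of desarrangements in $\mathfrak{S}_n$ avoiding every pattern in $\Pi$ ($\pi$ avoids $\sigma$ if no subsequence of $\pi$ has the same relative order as $\sigma$). *)

(* Defs.v *)
From mathcomp Require Import all_boot all_order all_algebra all_fingroup.

Set Implicit Arguments.
Unset Strict Implicit.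
Unset Printing Implicit Defensive.

(* A permutation [s : 'S_n] has one-line notation s_1 ... s_n, where the      *)
(* letter s_i is [s j] for the ordinal [j] of value i - 1.  Letters are thus  *)
(* 0-based, which does not affect comparisons; descent and ascent indices are *)
(* kept 1-based, since the definition of desarrangements uses their parity.   *)

Definition is_descent (n : nat) (s : 'S_n) (i : nat) : bool :=
  [exists j : 'I_n, exists k : 'I_n,
     [&& j.+1 == i, k == i :> nat & s k < s j]].

Definition is_ascent (n : nat) (s : 'S_n) (i : nat) : bool :=
  (1 <= i <= n) && ~~ is_descent s i.

Definition is_first_ascent (n : nat) (s : 'S_n) (i : nat) : bool :=
  is_ascent s i && [forall j : 'I_i, ~~ is_ascent s j].

(* The empty permutation has no ascent and is a desarrangement by convention. *)
Definition desarrangement (n : nat) (s : 'S_n) : bool :=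
  (n == 0) || [exists i : 'I_n.+1, is_first_ascent s i && ~~ odd i].

(* A pattern is given by its one-line notation; [f] lists the positions of a  *)
(* subsequence of [s].                                                        *)
Definition contains (n : nat) (s : 'S_n) (p : seq nat) : bool :=
  [exists f : {ffun 'I_(size p) -> 'I_n},
     [forall a : 'I_(size p), forall b : 'I_(size p), (a < b) ==> (f a < f b)] &&
     [forall a : 'I_(size p), forall b : 'I_(size p),
        (s (f a) < s (f b)) == (nth 0 p a < nth 0 p b)]].

Definition avoids (n : nat) (s : 'S_n) (p : seq nat) : bool := ~~ contains s p.

Definition d (n : nat) (Pi : seq (seq nat)) : nat :=
  #|[set s : 'S_n | desarrangement s & all (avoids s) Pi]|.

(* Main.v *)
Require Import Defs.
From mathcomp Require Import all_boot all_order all_algebra all_fingroup.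
From mathcomp Require Import zify ring lra.

Set Implicit Arguments.
Unset Strict Implicit.
Unset Printing Implicit Defensive.

(** In a permutation avoiding 123 and 231, the letters before the minimum
    decrease (231) and so do the letters after it (123); moreover the latter
    form an interval of values, since a letter [a] before the minimum and
    letters [b > a > c] after it would form 231.  Hence the first ascent is the
    position of the minimum, and the permutation is determined by that position
    together with the number [l] of letters before the minimum that are smaller
    than the letters after it.  With 0-based positions, desarrangements are the
    case where the minimum is at an odd position [k]: there are [k + 1] choices
    of [l], except that only one permutation ends with its minimum. *)

Lemma perm_lt_neq (n : nat) (s : 'S_n) (i j : 'I_n) :
  i < j -> s i != s j :> nat.
Proof.
by apply: contraTN => /eqP/val_inj/perm_inj ->; rewrite ltnn.
Qed.

Lemma contains3P (n : nat) (s : 'S_n) (a b c : nat) : uniq [:: a; b; c] ->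
  reflect (exists i j k : 'I_n,
             [/\ i < j < k, (s i < s j) = (a < b), (s i < s k) = (a < c)
               & (s j < s k) = (b < c)])
          (contains s [:: a; b; c]).
Proof.
rewrite /= !inE => abc; apply: (iffP existsP) => /=.
  case=> f /andP[/'forall_'forall_implyP fmono /'forall_'forall_eqP fpat].
  pose o x (h : x < 3) := Ordinal h.
  exists (f (@o 0 isT)), (f (@o 1 isT)), (f (@o 2 isT)).
  by split; rewrite ?fpat // !fmono.
case=> i [j [k [ijk sij sik sjk]]].
(* Distinctness of letters turns the three known comparisons into all nine that [contains] asks
   for. *)
have nij := perm_lt_neq s (ltac:(lia) : i < j).
have nik := perm_lt_neq s (ltac:(lia) : i < k).
have njk := perm_lt_neq s (ltac:(lia) : j < k).
exists [ffun x : 'I_3 => nth i [:: i; j; k] x].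
apply/andP; split; apply/'forall_forallP => -[[|[|[|//]]] hx] -[[|[|[|//]]] hy];
  rewrite !ffunE /=; lia.
Qed.

Lemma card_ord_ltn (n m : nat) : m <= n -> #|[set x : 'I_n | x < m]| = m.
Proof.
move=> le_mn; rewrite -sum1dep_card.
by rewrite -(big_ord_widen n (fun=> 1) le_mn) sum1_card card_ord.
Qed.

(** Each letter is the number of positions holding a smaller letter, so relative order determines
    the values. *)
Lemma perm_order_inj (n : nat) (s t : 'S_n) :
  (forall i j : 'I_n, i < j -> (s i < s j) = (t i < t j)) -> s = t.
Proof.
have rank (u : 'S_n) i : #|[set j | u j < u i]| = u i.
  have -> : [set j | u j < u i] = u @^-1: [set x : 'I_n | x < u i].
    by apply/setP => j; rewrite !inE.
  by rewrite card_preimset ?card_ord_ltn //; [exact/ltnW | exact: perm_inj].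
move=> st; apply/permP => i; apply/ord_inj; rewrite -(rank s) -(rank t).
apply: eq_card => j; rewrite !inE.
case: (ltngtP i j) => [ij | ji | /ord_inj->]; last by rewrite !ltnn.
  by have := st i j ij; have := perm_lt_neq s ij; have := perm_lt_neq t ij; lia.
exact: st.
Qed.

(** The first ascent has 1-based index [k.+1]. If [k] is the last position, the second hypothesis is
    vacuous, in accordance with the final index always being an ascent. *)
Lemma desarrangement_descending_prefix (N : nat) (s : 'S_N.+1) (k : 'I_N.+1) :
    (forall i j : 'I_N.+1, i < j <= k -> s j < s i) ->
    (forall j : 'I_N.+1, j = k.+1 :> nat -> s k < s j) ->
  desarrangement s = odd k.
Proof.
move=> desc asc.
have ascE i : i <= k.+1 -> is_ascent s i = (i == k.+1).
  move=> leik; rewrite /is_ascent; case: (eqVneq i k.+1) => [-> | neq].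
    rewrite /= ltn_ord /=; apply/existsP => -[x /existsP[y /and3P[/eqP[xk] /eqP yk]]].
    by rewrite (val_inj xk : x = k); have := asc y yk; lia.
  case: i leik neq => // i leik neq; apply/negbTE; rewrite negb_and negbK.
  have ltk := ltn_ord k; have lti : i.+1 < N.+1 by lia.
  apply/orP; right; apply/existsP; exists (Ordinal (ltnW lti)).
  apply/existsP; exists (Ordinal lti); rewrite /= !eqxx /=.
  by apply: desc => /=; lia.
have first i : is_first_ascent s i = (i == k.+1).
  rewrite /is_first_ascent; apply/andP/eqP => [[ai /forallP none] | ->].
    case: (ltngtP i k.+1) => // [lt | gt].
      by move: ai; rewrite ascE; lia.
    by have := none (Ordinal gt); rewrite ascE ?eqxx.
  split; first by rewrite ascE ?eqxx.
  apply/forallP => j; have ltj := ltn_ord j; rewrite ascE; last exact: ltnW.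
  by rewrite neq_ltn ltj.
rewrite /desarrangement /=; apply/existsP/idP => [[i] | oddk].
  by rewrite first => /andP[/eqP ->] /=; rewrite negbK.
have ltk : k.+1 < N.+2 by rewrite ltnS.
by exists (Ordinal ltk); rewrite first eqxx /= negbK.
Qed.

(* The minimum sits at position [k]; it is preceded by the letters
   [N, ..., N - k + l + 1] and then [l, ..., 1], and followed by
   [N - k + l, ..., l + 1]. *)
Definition letter (N k l i : nat) : nat :=
  if i < k - l then N - i else if i <= k then k - i else (l + (N - i)).+1.

Definition letter_perm_fun (N : nat) (p : 'I_N.+1 * 'I_N.+1) (i : 'I_N.+1) :
  'I_N.+1 := inord (letter N p.1 p.2 i).

(* When [k = N] the letters do not depend on [l], hence the normalisation. *)
Definition admissible (N : nat) (p : 'I_N.+1 * 'I_N.+1) : bool :=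
  (p.2 <= p.1) && ((p.1 == N :> nat) ==> (p.2 == 0 :> nat)).

Local Ltac letter_lia := rewrite /letter /=; repeat case: ifP; lia.

Lemma letter_perm_exists (N : nat) (p : 'I_N.+1 * 'I_N.+1) : admissible p ->
  exists s : 'S_N.+1, forall i, s i = letter N p.1 p.2 i :> nat.
Proof.
move=> adm.
have val_fun i : letter_perm_fun p i = letter N p.1 p.2 i :> nat.
  rewrite inordK //; move: adm; rewrite /admissible.
  by have := ltn_ord i; have := ltn_ord p.1; letter_lia.
have inj : injective (letter_perm_fun p).
  move=> i j /(congr1 val); rewrite /= !val_fun => eq_ij; apply/ord_inj.
  move: adm eq_ij; rewrite /admissible.
  by have := ltn_ord i; have := ltn_ord j; have := ltn_ord p.1; letter_lia.
by exists (perm inj) => i; rewrite permE.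
Qed.

Local Notation avoiders n :=
  [set s : 'S_n | desarrangement s
     & all (avoids s) [:: [:: 1; 2; 3]; [:: 2; 3; 1]]].

Lemma avoids_123_231P (n : nat) (s : 'S_n) :
  reflect (forall i j k : 'I_n, i < j < k -> ~~ (s i < s j < s k) /\ ~~ (s k < s i < s j))
          (all (avoids s) [:: [:: 1; 2; 3]; [:: 2; 3; 1]]).
Proof.
rewrite /= andbT; apply: (iffP andP) => [[/contains3P av1 /contains3P av2] i j k ijk | av].
  split; apply/negP => lts; [case: av1 | case: av2] => //; exists i, j, k;
  split=> //; lia.
by split; apply/contains3P => // -[i [j [k [ijk]]]]; have [] := av i j k ijk;
  have := perm_lt_neq s (ltac:(lia) : i < k); lia.
Qed.

Lemma letter_perm_avoider (N : nat) (p : 'I_N.+1 * 'I_N.+1) (s : 'S_N.+1) :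
    admissible p -> (forall i, s i = letter N p.1 p.2 i :> nat) ->
  (s \in avoiders N.+1) = odd p.1.
Proof.
case: p => k l adm sE; rewrite /admissible /= in adm sE.
have av : all (avoids s) [:: [:: 1; 2; 3]; [:: 2; 3; 1]].
  apply/avoids_123_231P => i j m ijm; rewrite !sE.
  by split; have := ltn_ord m; have := ltn_ord k; letter_lia.
rewrite in_set av andbT; have ltk := ltn_ord k.
by apply: (@desarrangement_descending_prefix N s k) => [i j | j jk]; rewrite !sE;
  have := ltn_ord j; letter_lia.
Qed.

(** Rather than computing the values of [s], the proof extracts [k] and [l] and matches the relative
    order of [s] with that of the corresponding explicit permutation. *)
Lemma avoider_letter (N : nat) (s : 'S_N.+1) :
    all (avoids s) [:: [:: 1; 2; 3]; [:: 2; 3; 1]] ->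
  exists2 p : 'I_N.+1 * 'I_N.+1,
    admissible p & forall i, s i = letter N p.1 p.2 i :> nat.
Proof.
move/avoids_123_231P => av.
pose k := (s^-1 ord0)%g; have sk : s k = 0 :> nat by rewrite permKV.
have s_neq i j := @perm_lt_neq _ s i j.
have ltk := ltn_ord k.
have before (i j : 'I_N.+1) : i < j < k -> s j < s i.
  by move=> /[dup] /av; have := s_neq i j; have := s_neq i k; lia.
have after (i j : 'I_N.+1) : k < i < j -> s j < s i.
  by move=> /[dup] /av; have := s_neq i j; have := s_neq k i; lia.
(* The last letter can stand for all letters after the minimum: [s ord_max < s i < s j] would be a
   231. *)
have small (i j : 'I_N.+1) : i < k < j -> (s i < s j) = (s i < s ord_max).
  move=> ikj; have leN := leq_ord j; have niN := s_neq i ord_max ltac:(simpl; lia).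
  case: (eqVneq j ord_max) => [-> //|]; rewrite -val_eqE /= => njN.
  have := av i j ord_max ltac:(simpl; lia); have := after j ord_max ltac:(simpl; lia).
  lia.
(* The least such [m] is where the letters below the last one begin; the first disjunct gives
   [m = k] if there are none before the minimum. *)
have exm : exists m, (k <= m) || (s (inord m) < s ord_max).
  by exists k; rewrite leqnn.
case: (ex_minnP exm) => m mP mmin.
have lemk : m <= k by apply: mmin; rewrite leqnn.
have thr (i : 'I_N.+1) : i < k -> (s i < s ord_max) = (m <= i).
  move=> ltik; apply/idP/idP => [lts | lemi].
    by apply: mmin; rewrite inord_val lts orbT.
  have {}mP : s (inord m) < s ord_max by move: mP; lia.
  case: (eqVneq m i) mP => [-> | nmi mP]; first by rewrite inord_val.
  apply: ltn_trans mP; apply: before; rewrite inordK; lia.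
pose p : 'I_N.+1 * 'I_N.+1 := (k, inord (k - m)).
have p2 : p.2 = k - m :> nat by rewrite inordK //; lia.
have adm : admissible p.
  rewrite /admissible p2 /= leq_subr /=; apply/implyP => /eqP kN.
  case/orP: mP => [|]; first by lia.
  by rewrite -(_ : k = ord_max) ?sk //; apply/ord_inj.
exists p => // i; have [t tE] := letter_perm_exists adm.
rewrite -tE; congr (nat_of_ord (fun_of_perm _ i)).
apply: perm_order_inj => {}i j.
rewrite !tE p2 => ltij; have ltj := ltn_ord j.
case: (ltngtP j k) => [jk | kj | /ord_inj jk].
- by rewrite ltnNge ltnW ?before ?ltij //; letter_lia.
- case: (ltngtP i k) => [ik | ki | /ord_inj ik].
  + by rewrite small ?ik // thr //; letter_lia.
  + by rewrite ltnNge ltnW ?after ?ki //; letter_lia.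
  + have := s_neq i j ltij; rewrite ik sk; letter_lia.
- by rewrite jk sk; letter_lia.
Qed.

(** The last letter is [l.+1] if [k < N]; if [k = N] it is 0, whose truncated predecessor is the
    normalised [l = 0]. *)
Definition min_and_gap (N : nat) (s : 'S_N.+1) : 'I_N.+1 * 'I_N.+1 :=
  ((s^-1 ord0)%g, inord (s ord_max).-1).

Lemma min_and_gap_letter (N : nat) (p : 'I_N.+1 * 'I_N.+1) (s : 'S_N.+1) :
    admissible p -> (forall i, s i = letter N p.1 p.2 i :> nat) ->
  min_and_gap s = p.
Proof.
case: p => k l; rewrite /admissible /= => adm sE; have ltk := ltn_ord k.
congr pair.
  apply: (canLR (permK s)); apply/ord_inj; rewrite sE; letter_lia.
apply/ord_inj; rewrite sE inordK; letter_lia.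
Qed.

Lemma card_avoiders (N : nat) :
  #|avoiders N.+1| = #|[set p : 'I_N.+1 * 'I_N.+1 | admissible p && odd p.1]|.
Proof.
have repr (s : 'S_N.+1) : s \in avoiders N.+1 ->
    admissible (min_and_gap s) /\
    forall i, s i = letter N (min_and_gap s).1 (min_and_gap s).2 i :> nat.
  rewrite inE => /andP[_ /avoider_letter[p adm sE]].
  by rewrite (min_and_gap_letter adm sE).
rewrite -(card_in_imset (f := @min_and_gap N)); last first.
  move=> s t /repr[_ sE] /repr[_ tE] eq_st; apply/permP => i; apply/ord_inj.
  by rewrite sE tE eq_st.
apply: eq_card => p; rewrite [RHS]inE; apply/imsetP/andP => [[s sA ->] | [adm oddp]].
  by have [adm sE] := repr s sA; rewrite -(letter_perm_avoider adm sE).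
have [s sE] := letter_perm_exists adm.
by exists s; rewrite ?(letter_perm_avoider adm sE) // (min_and_gap_letter adm sE).
Qed.

Lemma card_admissible_odd (N : nat) :
  #|[set p : 'I_N.+1 * 'I_N.+1 | admissible p && odd p.1]| =
  (\sum_(k < N | odd k) k.+1 + odd N)%N.
Proof.
rewrite -sum1dep_card.
transitivity (\sum_(k < N.+1 | odd k) \sum_(l < N.+1 | admissible (k, l)) 1).
  by rewrite pair_big_dep /=; apply: eq_bigl => -[k l] /=; rewrite andbC.
(* The term [k = N] is split off: it admits only [l = 0]. *)
rewrite big_mkcond big_ord_recr -big_mkcond /=; congr addn.
  apply: eq_bigr => k _; have ltk := ltn_ord k.
  rewrite sum1dep_card -[RHS](@card_ord_ltn N.+1); last by lia.
  by apply: eq_card => l; rewrite !inE /admissible /=; lia.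
case: (odd N) => //; rewrite sum1dep_card -[RHS](@card_ord_ltn N.+1) //.
by apply: eq_card => l; rewrite !inE /admissible /=; lia.
Qed.

(** The summands are 2, 4, ..., [2 * m./2]. *)
Lemma sum_odd_succ (m : nat) : \sum_(k < m | odd k) k.+1 = (m./2 * m./2.+1)%N.
Proof.
elim: m => [|m IH]; first by rewrite big_ord0.
rewrite big_mkcond big_ord_recr -big_mkcond /= IH uphalf_half.
by have := odd_double_half m; case: (odd m) => /=; nia.
Qed.

Import GRing.Theory.

Theorem theorem3p20 (n : nat) :
  ((d n [:: [:: 1; 2; 3]; [:: 2; 3; 1]]%N)%:R : rat)%R =
  ((2 * n%:R * (n%:R - 1) + (5 - 2 * n%:R) * (-1) ^+ n + 3) / 8)%R.
Proof.
case: n => [|N].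
  rewrite /d (_ : [set _ | _ & _] = setT) ?cardsT ?card_Sn ?fact0 ?expr0; first by lra.
  apply/setP => s; rewrite !inE /=; apply/idP/avoids_123_231P => //.
  by case.
rewrite /d card_avoiders card_admissible_odd sum_odd_succ.
(* For each parity of [N], this leaves a polynomial identity in [N./2]. *)
have NE : (N%:R = (odd N)%:R + 2 * N./2%:R :> rat)%R.
  by rewrite -natrM -natrD mul2n odd_double_half.
rewrite -signr_odd /= natrD natrM -!natr1 NE.
by case: (odd N) => /=; rewrite ?expr0 ?expr1; field.
Qed.
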